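(* Let $\{x_n\}$ be a sequence in a cone metric space $(X,d)$, and let $r\in E$ with $0\ll r$ or $r=0$. Let $m$ be a real number greater than $2$. Then there do not exist elements $y,z\in LIM^{r}x_n$ such that $mr<d(y,z)$.
   Context: Let $E$ be a real Banach space. A subset $P\subset E$ is a cone if (i) $P$ is closed, nonempty and $P\neq\{0\}$; (ii) $a,b\in\mathbb{R}$, $a,b\ge 0$, $x,y\in P$ implies $ax+by\in P$; (iii) $x\in P$ and $-x\in P$ implies $x=0$. Write $x\le y$ if $y-x\in P$, $x<y$ if $x\le y$ and $x\ne y$, and $x\ll y$ if $y-x\in \mathrm{int}\,P$ (the interior of $P$). A cone metric space $(X,d)$ (associated with $E$ and $P$) is a nonempty set $X$ with a map $d:X\times X\to E$ such that for all $x,y,z\in X$: $0\le d(x,y)$, and $d(x,y)=0$ iff $x=y$; $d(x,y)=d(y,x)$; $d(x,y)\le d(x,z)+d(z,y)$. For $r\in E$ with $0\ll r$ or $r=0$, a sequence $\{x_n\}$ in $X$ is $r$-convergent to $x\in X$ if for every $\epsilon\in E$ with $0\ll\epsilon$ there is $k\in\mathbb{N}$ such that $d(x_n,x)\ll r+\epsilon$ for all $n\ge k$. The $r$-limit set is $LIM^{r}x_n=\{x\in X: \{x_n\}\text{ is } r\text{-convergent to } x\}$.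
   Formalization: The cone P is assumed to have nonempty interior; this matters only for r = 0, where with empty interior every sequence is vacuously 0-convergent to every point, so any two distinct points y, z satisfy m·0 < d(y,z) and the claim fails. *)

(* Defs.v *)
From HB Require Import structures.
From mathcomp Require Import all_boot all_order all_algebra.
From mathcomp Require Import all_classical all_reals all_analysis.
Import numFieldNormedType.Exports.
Set Implicit Arguments.
Unset Strict Implicit.
Unset Printing Implicit Defensive.
Import Order.TTheory GRing.Theory Num.Theory.
Local Open Scope classical_set_scope.
Local Open Scope ring_scope.

(* As in the usual definition, a cone may have empty interior. *)
Record is_cone (R : realType) (E : completeNormedModType R) (P : set E) : Prop :=
  IsCone {
    cone_closed : closed P;
    cone_nonempty : P !=set0;
    cone_neq0 : P <> [set 0];
    cone_comb : forall (a b : R) (x y : E),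
      0 <= a -> 0 <= b -> P x -> P y -> P (a *: x + b *: y);
    cone_salient : forall x : E, P x -> P (- x) -> x = 0 }.

Definition cone_le (R : realType) (E : completeNormedModType R) (P : set E)
  (x y : E) : Prop := P (y - x).

Definition cone_lt (R : realType) (E : completeNormedModType R) (P : set E)
  (x y : E) : Prop := cone_le P x y /\ x <> y.

(* The relation written x << y in the literature. *)
Definition cone_ll (R : realType) (E : completeNormedModType R) (P : set E)
  (x y : E) : Prop := interior P (y - x).

Record is_cone_metric (R : realType) (E : completeNormedModType R) (P : set E)
    (X : Type) (d : X -> X -> E) : Prop :=
  IsConeMetric {
    cone_metric_inhabited : inhabited X;
    cone_metric_ge0 : forall x y : X, cone_le P 0 (d x y);
    cone_metric_eq0 : forall x y : X, d x y = 0 <-> x = y;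
    cone_metric_sym : forall x y : X, d x y = d y x;
    cone_metric_triangle : forall x y z : X,
      cone_le P (d x y) (d x z + d z y) }.

Definition r_convergent (R : realType) (E : completeNormedModType R)
    (P : set E) (X : Type) (d : X -> X -> E) (r : E) (u : nat -> X) (x : X)
    : Prop :=
  forall eps : E, cone_ll P 0 eps ->
    exists k : nat, forall n : nat, (k <= n)%N ->
      cone_ll P (d (u n) x) (r + eps).

Definition LIM (R : realType) (E : completeNormedModType R)
    (P : set E) (X : Type) (d : X -> X -> E) (r : E) (u : nat -> X) : set X :=
  [set x | r_convergent P d r u x].

(* Main.v *)
Require Import Defs.
From HB Require Import structures.
From mathcomp Require Import all_boot all_order all_algebra.
From mathcomp Require Import all_classical all_reals all_analysis.
Import numFieldNormedType.Exports.
Set Implicit Arguments.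
Unset Strict Implicit.
Unset Printing Implicit Defensive.
Import Order.TTheory GRing.Theory Num.Theory.
Local Open Scope classical_set_scope.
Local Open Scope ring_scope.

(* Letting the error tend to 0 along a ray inside int P, closedness of P gives
   d(y,z) <= 2r for all y, z in LIM^r. Together with mr <= d(y,z) this puts
   -(m-2)r in P, so r = 0 by salience, and then d(y,z) = 0 = mr. *)

(** The preimage of [P] under the continuous map [x |-> t^-1 *: x] is a neighbourhood of [t *: c],
    and it lies in [P] because scaling back by [t] stays in the cone. *)
Lemma cone_interior_scale (R : realType) (E : completeNormedModType R)
    (P : set E) (t : R) (c : E) :
  is_cone P -> 0 < t -> interior P c -> interior P (t *: c).
Proof.
move=> hP t0 Pc; rewrite /interior /=.
have tK (x : E) : t *: (t^-1 *: x) = x by rewrite scalerA mulfV ?gt_eqF// scale1r.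
have {}Pc : nbhs (t^-1 *: (t *: c)) P by rewrite scalerA mulVf ?gt_eqF// scale1r.
have : nbhs (t *: c) ( *:%R t^-1 @^-1` P) by exact: scaler_continuous.
apply: filterS => x /= Px.
by have := cone_comb hP (ltW t0) (lexx 0) Px Px; rewrite tK scale0r addr0.
Qed.

Lemma closed_ray_origin (R : realType) (E : completeNormedModType R)
    (P : set E) (x c : E) :
  closed P -> (forall t : R, 0 < t -> P (x + t *: c)) -> P x.
Proof.
move=> cP Pt.
have cvx : x + t *: c @[t --> (0 : R)^'+] --> x.
  rewrite -[X in _ --> X]addr0 -(scale0r c).
  apply: cvgD; first exact: cvg_cst.
  apply: cvgZr_tmp; exact: cvg_at_right_filter.
apply: (closed_cvg P cP _ _ cvx).
by near=> t; apply: Pt; near: t; exact: nbhs_right_gt.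
Unshelve. all: by end_near. Qed.

Lemma cone_add (R : realType) (E : completeNormedModType R) (P : set E)
    (x y : E) :
  is_cone P -> P x -> P y -> P (x + y).
Proof.
by move=> hP Px Py; have := cone_comb hP ler01 ler01 Px Py; rewrite !scale1r.
Qed.

(** An interior point [c] supplies the admissible errors [t *: c]. If [P] had empty interior, every
    point would be an [r]-limit vacuously and no such bound could be expected. *)
Lemma LIM_dist_le (R : realType) (E : completeNormedModType R) (P : set E)
    (X : Type) (d : X -> X -> E) (u : nat -> X) (r : E) (y z : X) :
  is_cone P -> interior P !=set0 -> is_cone_metric P d ->
  LIM P d r u y -> LIM P d r u z -> cone_le P (d y z) (r + r).
Proof.
move=> hP [c Pc] hd Ly Lz.
(* The direction is [c + c] because the estimates at [y] and at [z] each cost an error [t *: c]. *)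
apply: (@closed_ray_origin _ _ P _ (c + c) (cone_closed hP)) => t t0.
have tc : cone_ll P 0 (t *: c).
  by rewrite /cone_ll subr0; exact: cone_interior_scale.
have [ky hy] := Ly _ tc; have [kz hz] := Lz _ tc.
have /(@interior_subset _ P) Py := hy _ (leq_maxl ky kz).
have /(@interior_subset _ P) Pz := hz _ (leq_maxr ky kz).
(* In the sum of these three elements of [P] the distances to [u (maxn ky kz)] cancel, leaving
   [r + r - d y z + t *: (c + c)]; the rest is this identity in an abelian group. *)
have := cone_add hP (cone_metric_triangle hd y z (u (maxn ky kz)))
  (cone_add hP Py Pz).
rewrite (cone_metric_sym hd y (u _)); congr P.
move: (d (u _) y) (d (u _) z) (d y z) => a b e.
rewrite scalerDr; move: (t *: c) => s.
rewrite (addrACA (r + s)) -opprD; move: (a + b) => w.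
rewrite [LHS]addrC [LHS]addrA subrK.
by rewrite (addrACA r) addrAC.
Qed.

Theorem theorem3p4 (R : realType) (E : completeNormedModType R) (P : set E)
  (hP : is_cone P) (hint : interior P !=set0)
  (X : Type) (d : X -> X -> E) (hd : is_cone_metric P d)
  (u : nat -> X) (r : E) (hr : cone_ll P 0 r \/ r = 0)
  (m : R) (hm : 2 < m) :
  ~ (exists y z : X,
       [/\ LIM P d r u y, LIM P d r u z & cone_lt P (m *: r) (d y z)]).
Proof.
move=> [y [z [Ly Lz [Pm neq]]]]; apply: neq.
have Pr : P r.
  case: hr => [|->]; first by rewrite /cone_ll subr0 => /interior_subset.
  (* The origin is in [P], as the combination of any element with both coefficients 0. *)
  have [p Pp] := cone_nonempty hP.
  by have := cone_comb hP (lexx 0) (lexx 0) Pp Pp; rewrite !scale0r addr0.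
have P2 := LIM_dist_le hP hint hd Ly Lz.
have m2 : 0 < m - 2 by rewrite subr_gt0.
have Pmr : P ((m - 2) *: r).
  by have := cone_comb hP (ltW m2) (lexx 0) Pr Pr; rewrite scale0r addr0.
have PNmr : P (- ((m - 2) *: r)).
  (* Here [d y z] cancels between [r + r - d y z] and [d y z - m *: r]. *)
  have := cone_add hP P2 Pm; congr P.
  by rewrite addrA subrK scalerBl opprB scaler_nat mulr2n.
have /eqP := cone_salient hP Pmr PNmr.
rewrite scaler_eq0 gt_eqF//= => /eqP r0.
move: Pm P2; rewrite /cone_le r0 scaler0 subr0 !add0r => Pd PNd.
by rewrite (cone_salient hP Pd PNd).
Qed.
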